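(* Let $p$ be a prime, $n\ge1$ an integer, and let $G$ be a GGS-group over the $p^n$-adic tree with constant defining vector. Then $G$ is not a branch group.
   Context: Let $m=p^n$ and $X=\{x_1,\dots,x_m\}$. The $p^n$-adic tree $\mathcal{T}$ is the rooted tree whose vertices are the words of the free monoid $X^*$ (root: the empty word), with $u$ and $ux$ joined by an edge for $u\in X^*$, $x\in X$; the $\ell$-th level $\mathcal{L}_\ell$ is the set of words of length $\ell$. $\mathrm{Aut}\,\mathcal{T}$ is the group of automorphisms of $\mathcal{T}$; products are composed left to right. For $f\in\mathrm{Aut}\,\mathcal{T}$ and $u\in X^*$, the section $f_u$ is defined by $f(uz)=f(u)f_u(z)$ for all $z\in X^*$. $\mathrm{st}(1)$ is the pointwise stabilizer of the first level, and $\psi:\mathrm{st}(1)\to(\mathrm{Aut}\,\mathcal{T})^{m}$, $\psi(f)=(f_{x_1},\dots,f_{x_m})$, is an isomorphism. GGS-groups: given a non-zero $\mathbf{e}=(e_1,\dots,e_{p^n-1})\in(\mathbb{Z}/p^n\mathbb{Z})^{p^n-1}$, the GGS-group with defining vector $\mathbf{e}$ is $G=\langle a,b\rangle$, where $a$ is the rooted automorphism $a(x_iz)=x_{i+1}z$ (indices modulo $p^n$, $z\in X^*$) and $b\in\mathrm{st}(1)$ is defined recursively by $\psi(b)=(a^{e_1},\dots,a^{e_{p^n-1}},b)$. The defining vector is constant if $e_1=\dots=e_{p^n-1}$. Branch groups: for $G\le\mathrm{Aut}\,\mathcal{T}$ and a vertex $u$, $\mathrm{rst}_G(u)$ is the subgroup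 of those elements of $G$ that fix all vertices that are not descendants of $u$ (descendants of $u$ being the words $uz$, $z\in X^*$), and $\mathrm{rst}_G(\ell)=\langle\mathrm{rst}_G(u)\mid u\in\mathcal{L}_\ell\rangle$. $G$ is branch if it is spherically transitive (i.e. transitive on every level) and $|G:\mathrm{rst}_G(\ell)|$ is finite for all $\ell$. *)

(* Defs.v *)
From HB Require Import structures.
From mathcomp Require Import all_boot all_order all_algebra.
From mathcomp Require Import boolp classical_sets functions cardinality.

Set Implicit Arguments.
Unset Strict Implicit.
Unset Printing Implicit Defensive.

Local Open Scope classical_set_scope.
Local Open Scope group_scope.

(* The letter x_i (1 <= i <= m) is the ordinal i - 1 of 'I_m; the free monoid
   on the letters is seq 'I_m, with concatenation ++. *)
Definition word (m : nat) := seq 'I_m.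

Definition adjacent (m : nat) (u v : word m) : bool :=
  [exists x, v == rcons u x] || [exists x, u == rcons v x].

Record taut (m : nat) := TAut {
  taut_fun :> word m -> word m;
  taut_bij : bijective taut_fun;
  taut_root : taut_fun [::] = [::];
  taut_adj : {mono taut_fun : u v / adjacent u v} }.

HB.instance Definition _ (m : nat) := gen_eqMixin (taut m).
HB.instance Definition _ (m : nat) := gen_choiceMixin (taut m).

Section AutGroup.
Variable m : nat.
Implicit Types f g h : taut m.

Lemma tautP f g : f =1 g -> f = g.
Proof.
case: f g => [f fb fr fa] [g gb gr ga] /= /funext efg.
by subst g; congr TAut; exact: Prop_irrelevance.
Qed.

Definition taut_one : taut m :=
  @TAut m id (Bijective (fun _ => erefl) (fun _ => erefl)) erefl
    (fun _ _ => erefl).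

Fact taut_mul_root f g : (g \o f) [::] = [::].
Proof. by rewrite /= !taut_root. Qed.

Fact taut_mul_adj f g : {mono g \o f : u v / adjacent u v}.
Proof. by move=> u v; rewrite /= !taut_adj. Qed.

(* Products are composed from left to right: (f * g) u = g (f u). *)
Definition taut_mul f g : taut m :=
  TAut (bij_comp (taut_bij g) (taut_bij f)) (taut_mul_root f g)
    (taut_mul_adj f g).

Fact taut_inv_exists f : exists g : word m -> word m, cancel f g /\ cancel g f.
Proof. by case: (taut_bij f) => g fK gK; exists g. Qed.

Definition taut_inv_fun f : word m -> word m := sval (cid (taut_inv_exists f)).

Fact taut_invK f : cancel (taut_inv_fun f) f.
Proof. by rewrite /taut_inv_fun; case: cid => g []. Qed.

Fact taut_funK f : cancel f (taut_inv_fun f).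
Proof. by rewrite /taut_inv_fun; case: cid => g []. Qed.

Fact taut_inv_root f : taut_inv_fun f [::] = [::].
Proof. by rewrite -[in LHS](taut_root f) taut_funK. Qed.

Fact taut_inv_adj f : {mono taut_inv_fun f : u v / adjacent u v}.
Proof. by move=> u v; rewrite -(taut_adj f) !taut_invK. Qed.

Definition taut_inv f : taut m :=
  TAut (Bijective (taut_invK f) (taut_funK f)) (taut_inv_root f)
    (taut_inv_adj f).

Fact taut_mulA : associative taut_mul.
Proof. by move=> f g h; exact: tautP. Qed.
Fact taut_mul1 : left_id taut_one taut_mul.
Proof. by move=> f; exact: tautP. Qed.
Fact taut_mulr1 : right_id taut_one taut_mul.
Proof. by move=> f; exact: tautP. Qed.
Fact taut_mulV : left_inverse taut_one taut_inv taut_mul.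
Proof. by move=> f; apply: tautP => u; exact: taut_invK. Qed.
Fact taut_mulrV : right_inverse taut_one taut_inv taut_mul.
Proof. by move=> f; apply: tautP => u; exact: taut_funK. Qed.

HB.instance Definition _ := isGroup.Build (taut m)
  taut_mulA taut_mul1 taut_mulr1 taut_mulV taut_mulrV.

Fact adj_of_rcons (f : word m -> word m) :
    injective f -> f [::] = [::] ->
    (forall u x, exists y, f (rcons u x) = rcons (f u) y) ->
  {mono f : u v / adjacent u v}.
Proof.
move=> fI f0 fS u v.
suff E u' v' : [exists x, f v' == rcons (f u') x] = [exists x, v' == rcons u' x].
  by rewrite /adjacent !E.
apply/existsP/existsP => -[x /eqP]; last first.
  by move=> ->; have [y ->] := fS u' x; exists y.
case/lastP: v' => [|w z]; first by rewrite f0 => /(congr1 size); rewrite size_rcons.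
have [y ->] := fS w z => /rcons_inj[/fI -> _].
by exists z.
Qed.

End AutGroup.

Section Generators.
Variable m : nat.

(* The letter x_{i+1}, indices modulo m, is ordS x_i. *)
Definition rooted_fun (w : word m) : word m :=
  if w is x :: z then ordS x :: z else [::].

Fact rooted_bij : bijective rooted_fun.
Proof.
exists (fun w => if w is x :: z then ord_pred x :: z else [::]).
  by case=> [|x z] //=; rewrite ordSK.
by case=> [|x z] //=; rewrite ord_predK.
Qed.

Fact rooted_adj : {mono rooted_fun : u v / adjacent u v}.
Proof.
apply: adj_of_rcons => //; first exact: bij_inj rooted_bij.
by case=> [|y u] x; [exists (ordS x) | exists x].
Qed.

Definition rooted : taut m := TAut rooted_bij erefl rooted_adj.

Variable e : 'rV['Z_m]_(m.-1).

(* psi(b) = (a^{e_1}, ..., a^{e_{m-1}}, b). The entry e_i is e 0 (i - 1), used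
   through its representative in nat; insub x is None exactly when x is the
   last letter x_m. *)
Fixpoint directed_fun (w : word m) : word m :=
  if w is x :: z then
    x :: (if insub (val x) : option 'I_(m.-1) is Some i
          then (rooted ^+ (e ord0 i)) z else directed_fun z)
  else [::].

Fact taut_rcons (f : taut m) u x : exists y, f (rcons u x) = rcons (f u) y.
Proof.
have [n] := ubnP (size u); elim: n u x => // n IH u x.
rewrite ltnS => un.
have: adjacent u (rcons u x) by apply/orP; left; apply/existsP; exists x.
rewrite -(taut_adj f) => /orP[/existsP[y /eqP->]|/existsP[y /eqP fu]].
  by exists y.
case/lastP: u un fu => [|w z] un fu.
  by move: fu; rewrite taut_root => /(congr1 size); rewrite size_rcons.
have [z' fwz] := IH w z ltac:(by rewrite size_rcons in un).
move: fu; rewrite fwz => /rcons_inj[/(bij_inj (taut_bij f))].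
by move/(congr1 size)/eqP; rewrite !size_rcons -addn2 -[X in X == _]addn0 eqn_add2l.
Qed.

Fact directed_bij : bijective directed_fun.
Proof.
pose fix g (w : word m) : word m :=
  if w is x :: z then
    x :: (if insub (val x) : option 'I_(m.-1) is Some i
          then (rooted ^+ (e ord0 i))^-1 z else g z)
  else [::].
exists g; elim=> [|x z IH] //=; congr (_ :: _); case: insub => [i|] //.
  exact: taut_funK.
exact: taut_invK.
Qed.

Fact directed_adj : {mono directed_fun : u v / adjacent u v}.
Proof.
apply: adj_of_rcons => //; first exact: bij_inj directed_bij.
elim=> [|y u IH] x /=.
  exists x; case: insub => [i|] //=.
  by rewrite taut_root.
case: insub => [i|] /=; last by have [t ->] := IH x; exists t.
by have [t ->] := taut_rcons (rooted ^+ (e ord0 i)) u x; exists t.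
Qed.

Definition directed : taut m := TAut directed_bij erefl directed_adj.

End Generators.

Definition subgroup_set (gT : groupType) (H : set gT) : Prop :=
  group_closed (mem H).

Definition generated (gT : groupType) (S : set gT) : set gT :=
  smallest (@subgroup_set gT) S.

(* |G : H| is finite, for H a subgroup of G. *)
Definition finite_index (gT : groupType) (G H : set gT) : Prop :=
  finite_set [set [set h * g | h in H] | g in G].

(* 'Z_m is the ring of integers modulo m only for m > 1; here m = p ^ n with
   p prime and n >= 1. *)
Definition GGS (m : nat) (e : 'rV['Z_m]_(m.-1)) : set (taut m) :=
  generated [set rooted m; directed e].

Definition constant_vector (m : nat) (e : 'rV['Z_m]_(m.-1)) : Prop :=
  forall i j, e ord0 i = e ord0 j.

(* The descendants of u, u itself included, are the words having u as a
   prefix. *)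
Definition rst (m : nat) (G : set (taut m)) (u : word m) : set (taut m) :=
  [set g | G g /\ forall v, ~~ prefix u v -> g v = v].

Definition rst_level (m : nat) (G : set (taut m)) (l : nat) : set (taut m) :=
  generated (\bigcup_(u in [set u : word m | size u = l]) rst G u).

Definition spherically_transitive (m : nat) (G : set (taut m)) : Prop :=
  forall (l : nat) (u v : word m), size u = l -> size v = l ->
  exists2 g, G g & g u = v.

Definition branch (m : nat) (G : set (taut m)) : Prop :=
  spherically_transitive G /\ forall l : nat, finite_index G (rst_level G l).

(* Main.v *)
Require Import Defs.
From mathcomp Require Import all_boot all_order all_algebra.
From mathcomp Require Import all_field.
From mathcomp Require Import boolp classical_sets functions cardinality.
Set Implicit Arguments.
Unset Strict Implicit.
Unset Printing Implicit Defensive.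
Import GRing.Theory Num.Theory.
Local Open Scope ring_scope.

(** Let [a] and [b] be the rooted and the directed generator, let
[m = p ^ n] (a number of the form [k.+2]), let [c] be the common entry of the
defining vector, which is nonzero modulo [m], let [zeta] be a primitive [m]-th
root of unity and put [eta := zeta ^+ c], so that [eta <> 1].  The group acts on the complex line as a group of plane isometries:
[a] is the rotation by [zeta] about the origin, and [b] is the rotation by
[eta] followed by the translation by [1].  The proof is that this action is
well defined ([image_trivial]), has infinite image, and kills every section
of every element of [rst_G(1)].

All three facts come from comparing an element with its [m] sections at the
first level.  Write elements as positive words in [a] and [b], let [rot] and
[trans] be the rotation factor and the translation vector of a word, and let
[w_x] be the word for the section of [w] at the letter [x]: each [b] of [w]
contributes [b] to exactly one of the [w_x] and [a ^+ c] to all others.  Then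

- [rot w_x = eta ^+ #b(w)] for every [x], as [b] and [a ^+ c] rotate alike
  ([rot_sec]); this is where the constancy of the vector is used;
- [\sum_x trans w_x = 1 + eta + ... + eta ^+ (#b(w) - 1)] ([trans_sec_sum]);
- [trans w = \sum_x zeta ^+ (m - 1 - x) * trans w_x] ([trans_decomp]).

By the second identity, if [eta ^+ #b(w) = 1] and all the [trans w_x] but one
vanish, so does the last one ([trans_sec_single]).  If [w] represents [1], then
so do all [w_x], and unless [w] is a power of [a], all of them but at most one
contain fewer letters [b] than [w]; induction on the number of letters [b], with
[trans_sec_single] for the exceptional section, then gives [trans w_x = 0] for all
[x], hence [trans w = 0].  If [w] represents an element of [rst_G(x)] with [x]
of length one, then all sections but the one at [x] are trivial, so by the same
argument all sections of [w] act trivially ([rst_flat]), and this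
property passes to the group [rst_G(1)] that these elements generate.

On the other hand the powers of [b * (a * b * a^-1)^-1] lie in the stabilizer
of the first level, and their sections at the last letter, the powers of
[b * a ^- c], act by the translations by [0, 1, 2, ...].  Hence these powers
lie in different cosets of [rst_G(1)], and the index of [rst_G(1)] is
infinite. *)

(** * Words in the generators and their sections *)

Section Words.
Variables (k c : nat) (e : 'rV['Z_(k.+2)]_(k.+1)).
Hypothesis eE : forall i, e ord0 i = c :> nat.

(** [true] stands for the directed generator, [false] for the rooted one.
Positive words suffice because both generators have finite order. *)
Definition ev (w : seq bool) : taut k.+2 :=
  foldr (fun l f => ((if l then directed e else rooted k.+2) * f)%g) 1%g w.

Lemma ev_cat v w : ev (v ++ w) = (ev v * ev w)%g.
Proof. by elim: v => [|l v IH] /=; rewrite ?mul1g // IH mulgA. Qed.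

Lemma ev_rooted j : ev (nseq j false) = (rooted k.+2 ^+ j)%g.
Proof. by elim: j => [|j IH] //=; rewrite IH expgS. Qed.

Definition shift (w : seq bool) (x : 'I_k.+2) : 'I_k.+2 :=
  iter (count negb w) (@ordS k.+2) x.

Lemma shift_false w x : shift (false :: w) x = shift w (ordS x).
Proof. exact: iterSr. Qed.

(** The section at a first letter [x], as a word: [x] travels along the word,
moved by each rooted generator, and each directed generator emits its section
at the current letter. *)
Fixpoint sec (x : 'I_k.+2) (w : seq bool) : seq bool :=
  if w is l :: w' then
    if l then (if x == ord_max then [:: true] else nseq c false) ++ sec x w'
    else sec (ordS x) w'
  else [::].

Lemma ev_cons w x z : ev w (x :: z) = shift w x :: ev (sec x w) z.
Proof.
elim: w x z => [|[] w IH] x z //=; rewrite IH; first last.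
  by rewrite shift_false.
congr (_ :: _); rewrite ev_cat /=; congr (ev _ _).
case: insubP => [i lti _|]; case: eqP => [xE|nx] /=.
- by rewrite xE ltnn in lti.
- by rewrite eE ev_rooted.
- by [].
- by rewrite ltn_neqAle -ltnS ltn_ord andbT negbK => /eqP xE; case: nx; exact: val_inj.
Qed.

Lemma ev_nil w : ev w [::] = [::].
Proof. exact: taut_root. Qed.

Lemma val_shift w x : shift w x = ((x + count negb w) %% k.+2)%N :> nat.
Proof.
rewrite /shift; elim: (count _ _) => [|j IH] /=.
  by rewrite addn0 modn_small.
by rewrite IH -addn1 modnDml addn1 addnS.
Qed.

Lemma shift_id w x : (shift w x == x) = (k.+2 %| count negb w)%N.
Proof.
rewrite -val_eqE /= val_shift -{2}(modn_small (ltn_ord x)).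
by rewrite -{2}[x : nat]addn0 eqn_modDl mod0n.
Qed.

Lemma sec_cat x v w : sec x (v ++ w) = sec x v ++ sec (shift v x) w.
Proof.
by elim: v x => [|[] v IH] x //=; rewrite IH ?catA ?shift_false.
Qed.

(** Different words for the same element may have different words as sections,
but these represent the same element, since sections are determined by the
action. *)
Lemma ev_sec v w x : ev v = ev w -> ev (sec x v) = ev (sec x w).
Proof.
move=> vw; apply: tautP => z; have := ev_cons v x z.
by rewrite vw ev_cons => -[].
Qed.

Lemma ev_eq1 w : ev w = 1%g ->
  (k.+2 %| count negb w)%N /\ forall x, ev (sec x w) = 1%g.
Proof.
move=> w1; split=> [|x]; last by rewrite (@ev_sec w [::]).
by have := ev_cons w ord0 [::]; rewrite w1 => -[/esym/eqP]; rewrite shift_id.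
Qed.

Definition pow (w : seq bool) r := flatten (nseq r w).

Lemma sec_pow x w r : shift w x = x -> sec x (pow w r) = pow (sec x w) r.
Proof. by move=> wx; elim: r => [|r IH] //=; rewrite sec_cat wx IH. Qed.

Lemma ev_pow w r : ev (pow w r) = (ev w ^+ r)%g.
Proof. by elim: r => [|r IH] //=; rewrite ev_cat IH expgS. Qed.

Lemma sec_rooted x j : sec x (nseq j false) = [::].
Proof. by elim: j x => //=. Qed.

Lemma sec_directed x j : x != ord_max ->
  sec x (nseq j true) = nseq (j * c) false.
Proof. by move=> /negPf xm; elim: j => //= j ->; rewrite xm -nseqD. Qed.

Lemma rooted_order : (rooted k.+2 ^+ k.+2)%g = 1%g.
Proof.
apply: tautP => -[|x z]; rewrite -ev_rooted ?ev_nil // ev_cons.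
rewrite (eqP (_ : shift _ x == x)); last by rewrite shift_id count_nseq mul1n.
by rewrite sec_rooted.
Qed.

(** At a letter other than the last one, the section of [b ^+ m] is
[a ^+ (c * m) = 1]; at the last letter it is [b ^+ m] again, so induction on
the length of the words acted upon applies. *)
Lemma directed_order : (directed e ^+ k.+2)%g = 1%g.
Proof.
have evb : ev [:: true] = directed e by rewrite /= mulg1.
apply: tautP; elim=> [|x z IH]; first exact: taut_root.
rewrite -evb -ev_pow ev_cons.
rewrite (eqP (_ : shift _ x == x)); last first.
  by rewrite shift_id /pow count_flatten map_nseq sumn_nseq.
have -> : sec x (pow [:: true] k.+2)
    = pow (if x == ord_max then [:: true] else nseq c false) k.+2.
  by rewrite sec_pow //= cats0.
rewrite ev_pow; congr (_ :: _).
case: eqP => _; first by rewrite evb IH.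
by rewrite ev_rooted -expgnA mulnC expgnA rooted_order expg1n.
Qed.

Lemma ev_inv w : exists w', (ev w)^-1%g = ev w'.
Proof.
elim: w => [|l w [w' ew']]; first by exists [::]; rewrite invg1.
pose g := if l then directed e else rooted k.+2.
have evX j : ev (nseq j l) = (g ^+ j)%g by elim: j => //= j ->; rewrite -expgS.
have gX : (g ^+ k.+2)%g = 1%g.
  by rewrite /g; case: l {g evX}; rewrite ?directed_order ?rooted_order.
exists (w' ++ nseq k.+1 l); rewrite ev_cat -ew' evX [LHS]invgM.
by congr (_ * _)%g; apply: (mulgI g); rewrite mulgV -expgS gX.
Qed.

(** * The action on the line by rotations and translations *)

Variables (F : numFieldType) (zeta : F).
Hypothesis zeta_prim : k.+2.-primitive_root zeta.
Let eta := zeta ^+ c.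
Hypothesis eta_neq1 : eta != 1.

(** [rot w] and [trans w] are the rotation factor and the translation vector of
the affine map [z |-> rot w * z + trans w] in which [b] is
[z |-> eta * z + 1] and [a] is [z |-> zeta * z]; the leftmost letter of a word
is the outermost map. *)
Definition rot (w : seq bool) : F :=
  foldr (fun l r => (if l then eta else zeta) * r) 1 w.

Definition trans (w : seq bool) : F :=
  foldr (fun (l : bool) t => if l then 1 + eta * t else zeta * t) 0 w.

Lemma rot_cat v w : rot (v ++ w) = rot v * rot w.
Proof. by elim: v => [|l v IH] /=; rewrite ?mul1r // IH mulrA. Qed.

Lemma trans_cat v w : trans (v ++ w) = trans v + rot v * trans w.
Proof.
elim: v => [|[] v IH] /=; first by rewrite add0r mul1r.
  by rewrite IH mulrDr !mulrA addrA.
by rewrite IH mulrDr !mulrA.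
Qed.

Lemma rot_rooted j : rot (nseq j false) = zeta ^+ j.
Proof. by elim: j => [|j IH] //=; rewrite IH exprS. Qed.

Lemma trans_rooted j : trans (nseq j false) = 0.
Proof. by elim: j => [|j IH] //=; rewrite IH mulr0. Qed.

Lemma rotE w : rot w = zeta ^+ count negb w * eta ^+ count id w.
Proof.
elim: w => [|[] w IH] /=; first by rewrite mulr1.
  by rewrite IH add0n mulrCA -exprS.
by rewrite IH add0n mulrA -exprS.
Qed.

(** The sections of [b] are [b] and [a ^+ c], which both rotate by [eta], so the
rotation factor of a section depends neither on [x] nor on the letters [a]. *)
Lemma rot_sec x w : rot (sec x w) = eta ^+ count id w.
Proof.
elim: w x => [|[] w IH] x //=; rewrite rot_cat IH exprS.
by case: eqP => _; rewrite ?rot_rooted /= ?mulr1.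
Qed.

Lemma sum_last (f : 'I_k.+2 -> F) :
  \sum_x f x * (x == ord_max)%:R = f ord_max.
Proof.
rewrite (bigD1 ord_max) //= eqxx mulr1 big1 ?addr0 // => x /negPf->.
by rewrite mulr0.
Qed.

Lemma trans_sec_true x w :
  trans (sec x (true :: w)) = (x == ord_max)%:R + eta * trans (sec x w).
Proof.
rewrite /= trans_cat; case: eqP => _ /=.
  by rewrite mulr0 addr0 mulr1.
by rewrite trans_rooted rot_rooted.
Qed.

Lemma ordS_bij : bijective (@ordS k.+2).
Proof. by exists (@ord_pred k.+2); [exact: ordSK | exact: ord_predK]. Qed.

(** A letter [b] of [w] that is preceded by [j] letters [b] contributes the
translation [eta ^+ j] to exactly one of the sections: the one at the letter
that has been moved to the last position when this [b] acts. *)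
Lemma trans_sec_sum w :
  \sum_x trans (sec x w) = \sum_(j < count id w) eta ^+ j.
Proof.
elim: w => [|[] w IH].
- by rewrite big_ord0 big1.
- rewrite (eq_bigr _ (fun x _ => trans_sec_true x w)) big_split /= -mulr_sumr IH.
  rewrite add1n [RHS]big_ord_recl; congr (_ + _).
    by rewrite -[RHS](sum_last (fun=> 1)); apply: eq_bigr => x _; rewrite mul1r.
  by rewrite mulr_sumr; apply: eq_bigr => j _; rewrite exprS.
- by rewrite /= add0n -IH [RHS](reindex (@ordS k.+2)) //; apply/onW_bij/ordS_bij.
Qed.

Lemma zeta_ordS (x : 'I_k.+2) : zeta ^+ (k.+1 - x) = zeta * zeta ^+ (k.+1 - ordS x).
Proof.
rewrite -exprS /=; have := ltn_ord x; rewrite ltnS leq_eqVlt => /orP[/eqP->|xk].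
  by rewrite modnn subnn subn0 (prim_expr_order zeta_prim).
by rewrite modn_small // subnS prednK // subn_gt0.
Qed.

(** Prefixing [w] by [a] shifts the sections cyclically and multiplies [trans w]
by [zeta]; the weights [zeta ^+ (m - 1 - x)] obey the same recursion, and give
weight [1] to the last letter, the only one at which [b] translates. *)
Lemma trans_decomp w :
  trans w = \sum_(x < k.+2) zeta ^+ (k.+1 - x) * trans (sec x w).
Proof.
elim: w => [|[] w IH].
- by rewrite big1 // => x _; rewrite mulr0.
- under eq_bigr do rewrite trans_sec_true mulrDr mulrCA.
  rewrite big_split /= -mulr_sumr -IH; congr (_ + _).
  by rewrite (sum_last (fun x : 'I_k.+2 => zeta ^+ (k.+1 - x))) subnn.
- rewrite /= IH mulr_sumr (reindex (@ordS k.+2)); last exact/onW_bij/ordS_bij.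
  by apply: eq_bigr => x _; rewrite mulrA -zeta_ordS.
Qed.

Lemma sec_count_sum w : (\sum_x count id (sec x w) = count id w)%N.
Proof.
elim: w => [|[] w IH].
- by rewrite big1.
- rewrite /= -IH; under eq_bigr do rewrite count_cat.
  rewrite big_split /= (bigD1 ord_max) //= big1 ?eqxx ?addn0 //.
  by move=> x /negPf->; rewrite count_nseq.
- by rewrite /= add0n -IH [RHS](reindex (@ordS k.+2)) //; apply/onW_bij/ordS_bij.
Qed.

(** The sum of all the translations is a geometric sum that vanishes as soon as
[eta ^+ count id w = 1], because [eta != 1]. *)
Lemma trans_sec_single w x : eta ^+ count id w = 1 ->
  (forall y, y != x -> trans (sec y w) = 0) -> trans (sec x w) = 0.
Proof.
move=> eta1 w0; have := trans_sec_sum w; rewrite (bigD1 x) //= big1 // addr0 => ->.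
have /eqP := subrX1 eta (count id w).
by rewrite eta1 subrr eq_sym mulf_eq0 subr_eq0 (negPf eta_neq1) /= => /eqP.
Qed.

Lemma exists_other (x : 'I_k.+2) : exists y, y != x.
Proof. by exists (ordS x); rewrite (shift_id [:: false] x : (ordS x == x) = _). Qed.

(** This is what makes the action on the line well defined on the group.  The
induction is on the number of letters [b]; the sections of a relation are again
relations. *)
Lemma image_trivial w : ev w = 1%g -> rot w = 1 /\ trans w = 0.
Proof.
have [n] := ubnP (count id w); elim: n w => // n IH w; rewrite ltnS => wn w1.
have [dvd_a sec1] := ev_eq1 w1.
have zeta1 : zeta ^+ count negb w = 1.
  by apply/eqP; rewrite -(prim_order_dvd zeta_prim).
have [/eqP b0|b_gt0] := posnP (count id w).
  split; first by rewrite rotE zeta1 (eqP b0) mulr1.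
  by elim: w b0 {IH wn w1 sec1 dvd_a zeta1} => [|[] w IH] //= /IH->; rewrite mulr0.
(* The letters b of w are shared out among the sections, so at most one
   section can contain all of them. *)
have [x xP] : exists x, forall y, y != x -> (count id (sec y w) < count id w)%N.
  have [x /eqP xw|none] := pickP (fun x => count id (sec x w) == count id w).
    exists x => y yx; suff /eqP-> : count id (sec y w) == 0%N by [].
    have /eqP := sec_count_sum w.
    rewrite (bigD1 x) //= (bigD1 y) //= xw -[X in _ == X]addn0 eqn_add2l.
    by rewrite addn_eq0 => /andP[].
  exists ord0 => y _; rewrite ltn_neqAle none /= -(sec_count_sum w).
  by rewrite (bigD1 y) //= leq_addr.
have IHy y : y != x -> rot (sec y w) = 1 /\ trans (sec y w) = 0.
  by move=> /xP yw; apply: IH (sec1 y); exact: leq_trans yw wn.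
have [y yx] := exists_other x.
have eta1 : eta ^+ count id w = 1 by have [] := IHy y yx; rewrite rot_sec.
split; first by rewrite rotE zeta1 eta1 mulr1.
have w0 z : trans (sec z w) = 0.
  have [->|/IHy[]//] := eqVneq z x.
  by apply: trans_sec_single => // z' /IHy[].
by rewrite trans_decomp big1 // => z _; rewrite w0 mulr0.
Qed.

Lemma trans_ev v w : ev v = ev w -> trans v = trans w.
Proof.
move=> vw; have [w' w'E] := ev_inv w.
have [] : rot (w ++ w') = 1 /\ trans (w ++ w') = 0.
  by apply: image_trivial; rewrite ev_cat -w'E mulgV.
have [] : rot (v ++ w') = 1 /\ trans (v ++ w') = 0.
  by apply: image_trivial; rewrite ev_cat -w'E vw mulgV.
rewrite !rot_cat !trans_cat => rv tv rw.
have w'0 : rot w' != 0.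
  by apply/negP => /eqP r0; move/eqP: rv; rewrite r0 mulr0 eq_sym oner_eq0.
move=> tw; have rvw : rot v = rot w by apply: (mulIf w'0); rewrite rv rw.
by apply: (addIr (rot w * trans w')); rewrite tw -rvw tv.
Qed.

(** * Sections of elements of the rigid stabilizer *)

(** The word fixes the first level and all its sections act trivially on the
line. *)
Definition flat w :=
  (k.+2 %| count negb w)%N /\
  forall x, rot (sec x w) = 1 /\ trans (sec x w) = 0.

Lemma flat_shift w x : flat w -> shift w x = x.
Proof. by case=> dvd _; apply/eqP; rewrite shift_id. Qed.

Lemma flat_cat v w : flat v -> flat w -> flat (v ++ w).
Proof.
move=> fv fw; split=> [|x]; first by rewrite count_cat dvdn_add //; [case: fv|case: fw].
rewrite sec_cat flat_shift // rot_cat trans_cat.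
by have [-> ->] := fv.2 x; have [-> ->] := fw.2 x; rewrite mulr1 mulr0 addr0.
Qed.

Lemma flat_inv w w' : (ev w)^-1%g = ev w' -> flat w -> flat w'.
Proof.
move=> w'E fw; have := @ev_eq1 (w ++ w'); rewrite ev_cat -w'E mulgV => /(_ erefl).
rewrite count_cat dvdn_addr; last by case: fw.
move=> [dvd s1]; split=> // x; have := image_trivial (s1 x).
rewrite sec_cat flat_shift // rot_cat trans_cat.
by have [-> ->] := fw.2 x; rewrite !mul1r add0r.
Qed.

Lemma GGS_ev g : GGS e g -> exists w, g = ev w.
Proof.
have sub : subgroup_set [set g | exists w, g = ev w]%classic.
  split=> [|u v]; rewrite !inE; first by exists [::].
  move=> [v1 ->] [v2 ->]; have [v3 v3E] := ev_inv v2.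
  by exists (v1 ++ v3); rewrite ev_cat -v3E.
move=> /(smallest_sub sub); apply=> _ [] ->.
- by exists [:: false]; rewrite /= mulg1.
- by exists [:: true]; rewrite /= mulg1.
Qed.

Lemma ev_GGS w : GGS e (ev w).
Proof.
move=> A [[A1 Adiv] genA]; elim: w => [|l w IH] /=; first by rewrite inE in A1.
have Al : A (if l then directed e else rooted k.+2).
  by apply: genA; case: l; [right | left].
have := Adiv (if l then directed e else rooted k.+2) (ev w)^-1%g.
rewrite invgK !inE; apply=> //.
by have := Adiv 1%g (ev w) A1; rewrite !inE div1g; apply.
Qed.

(** All sections other than the one at [x] are the identity; one of them shows
that [eta ^+ count id w = 1], so the remaining translation vanishes too. *)
Lemma rst_flat u g : size u = 1%N -> rst (GGS e) u g ->
  exists2 w, g = ev w & flat w.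
Proof.
case: u => [|x []] // _ [/GGS_ev[w ->] fixw]; exists w => //.
have fixy y z : y != x -> ev w (y :: z) = y :: z.
  by move=> yx; apply: fixw; rewrite /= eq_sym (negPf yx).
have secy y : y != x -> ev (sec y w) = 1%g.
  by move=> yx; apply: tautP => z; have := fixy y z yx; rewrite ev_cons => -[].
have [y yx] := exists_other x.
have eta1 : eta ^+ count id w = 1.
  by have [] := image_trivial (secy y yx); rewrite rot_sec.
split=> [|z].
  by rewrite -(shift_id w y); have := fixy y [::] yx; rewrite ev_cons => -[->].
split; first by rewrite rot_sec.
have [->|/secy/image_trivial[]//] := eqVneq z x.
by apply: trans_sec_single => // z' /secy/image_trivial[].
Qed.

Lemma rst1_flat g : rst_level (GGS e) 1 g -> exists2 w, g = ev w & flat w.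
Proof.
have sub : subgroup_set [set g | exists2 w, g = ev w & flat w]%classic.
  split=> [|u v]; rewrite !inE; first by exists [::].
  move=> [v1 -> f1] [v2 -> f2]; have [v3 v3E] := ev_inv v2.
  exists (v1 ++ v3); first by rewrite ev_cat -v3E.
  exact: flat_cat f1 (flat_inv v3E f2).
by move=> /(smallest_sub sub); apply=> h [u] /= su /(rst_flat su).
Qed.

(** * Infinitely many cosets *)

(** A positive word for [b * (a * b * a^-1)^-1]: its section at the last letter
is [b * a ^+ (c * (m - 1)) = b * a ^- c], a translation by [1]. *)
Definition witness := true :: false :: nseq k.+1 true ++ nseq k.+1 false.

Lemma shift_witness x : shift witness x = x.
Proof.
apply/eqP; rewrite shift_id /witness -[X in count _ X]/([:: true; false] ++ _).
by rewrite !count_cat !count_nseq mul1n.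
Qed.

Lemma witness_image r :
  rot (pow (sec ord_max witness) r) = 1 /\ trans (pow (sec ord_max witness) r) = r%:R.
Proof.
have secE : sec ord_max witness = true :: nseq (c * k.+1) false.
  rewrite /witness -[X in sec _ X]/([:: true; false] ++ _) !sec_cat sec_rooted.
  rewrite cats0 -[RHS]cat1s; congr (_ ++ _); first by rewrite /= eqxx.
  have -> : shift [:: true; false] ord_max = ord0.
    by apply: val_inj; rewrite /= modnn.
  by rewrite sec_directed // mulnC.
have rot1 : rot (sec ord_max witness) = 1.
  rewrite rot_sec /witness -[X in count _ X]/([:: true; false] ++ _).
  rewrite !count_cat !count_nseq mul1n mul0n !addn0 add1n.
  by rewrite -exprM mulnC exprM (prim_expr_order zeta_prim) expr1n.
have trans1 : trans (sec ord_max witness) = 1.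
  by rewrite secE /= trans_rooted mulr0 addr0.
elim: r => [|r [IHr IHt]] //=.
by rewrite rot_cat trans_cat rot1 trans1 IHr IHt !mul1r mulrS.
Qed.

(** If the [r]-th and the [s]-th power of the witness lie in the same coset,
their sections at the last letter translate by the same amount, that is,
[r = s] in a field of characteristic zero. *)
Lemma rst1_infinite_index : ~ finite_index (GGS e) (rst_level (GGS e) 1).
Proof.
set H := rst_level _ _ => fin; apply: infinite_nat.
pose coset g := [set (h * g)%g | h in H]%classic.
have coset_inj r s : coset (ev (pow witness r)) = coset (ev (pow witness s)) -> r = s.
  move=> rs.
  have : coset (ev (pow witness r)) (ev (pow witness r)).
    by exists 1%g; rewrite ?mul1g // => A [[A1 _] _]; rewrite inE in A1.
  rewrite rs => -[h /rst1_flat[w -> fw]]; rewrite -ev_cat => /(@ev_sec _ _ ord_max).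
  move/trans_ev; rewrite sec_cat flat_shift // !sec_pow ?shift_witness // trans_cat.
  have [-> ->] := fw.2 ord_max; rewrite mul1r add0r.
  have [_ ->] := witness_image r; have [_ ->] := witness_image s.
  by move/eqP; rewrite eqr_nat => /eqP.
apply: (@sub_finite_set _ _ ((fun r => coset (ev (pow witness r)))
    @^-1` [set coset g | g in GGS e])%classic).
  by move=> r _ /=; exists (ev (pow witness r)) => //; exact: ev_GGS.
apply: finite_preimage fin => r s _ _; exact: coset_inj.
Qed.

End Words.

Theorem theorem2 (p n : nat) (p_prime : prime p) (n_ge1 : (1 <= n)%N)
    (e : 'rV['Z_(p ^ n)]_((p ^ n).-1)) (e_neq0 : e != 0)
    (e_const : constant_vector e) :
  ~ branch (GGS e).
Proof.
have pn_gt1 : (1 < p ^ n)%N.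
  by rewrite -(exp1n n) ltn_exp2r // prime_gt1.
move: (p ^ n)%N pn_gt1 e e_neq0 e_const => [|[|k]] // _ e e_neq0 e_const.
have [i ei0] : exists i, e ord0 i != 0.
  apply/existsP; apply: contraNT e_neq0; rewrite negb_exists => /forallP e0.
  by apply/eqP/rowP => i; rewrite mxE; apply/eqP/negPn.
pose c : nat := e ord0 i.
have eE j : e ord0 j = c :> nat by rewrite (e_const j i).
have [zeta zeta_prim] := C_prim_root_exists (isT : (0 < k.+2)%N).
have eta_neq1 : zeta ^+ c != 1.
  rewrite -(prim_order_dvd zeta_prim) gtnNdvd ?lt0n //.
  exact: ltn_ord (e ord0 i).
by move=> [_ /(_ 1%N)]; exact: (rst1_infinite_index eE zeta_prim eta_neq1).
Qed.
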